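(* For every $\alpha\in(0,1]$ there exists a $\beta=\beta(\alpha)>0$ such that the following holds. Let $\mathcal{F}$ be a connected cover in a graph that does not have $K_5$ as a minor. If at least $\alpha\binom{|\mathcal{F}|}{3}$ of the triples in $\mathcal{F}$ are intersecting, then there is an intersecting subfamily in $\mathcal{F}$ of size at least $\beta|\mathcal{F}|$.
   Context: All graphs are finite, simple and undirected. $K_5$ is the complete graph on five vertices. A graph $H$ is a minor of $G$ if there exist pairwise disjoint connected subgraphs $G_v\subset G$, one for each vertex $v$ of $H$, such that for any adjacent vertices $u,v$ of $H$ there is an edge of $G$ connecting a vertex of $G_u$ to a vertex of $G_v$. For a family of non-empty sets $\mathcal{F}=\{S_1,\dots,S_n\}$ the nerve is the simplicial complex $N(\mathcal{F})=\{\sigma\subset[n] : \bigcap_{i\in\sigma}S_i\neq\emptyset\}$. (Families are indexed; repeated members are allowed.) A connected cover in a graph $G$ is a finite family $\mathcal{F}=\{G_1,\dots,G_n\}$ of (non-empty) induced subgraphs of $G$ such that $G_\sigma=\bigcap_{i\in\sigma}G_i$ is connected for every non-empty $\sigma\in N(\mathcal{F})$; the intersection of induced subgraphs is the subgraph induced by the intersection of their vertex sets, and the nerve is taken with respect to vertex sets. A subfamily (in particular a triple) is intersecting if the intersection of all its members is non-empty. *)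

(* Defs.v *)
From mathcomp Require Import all_boot.

Set Implicit Arguments.
Unset Strict Implicit.
Unset Printing Implicit Defensive.

Record sgraph := SGraph {
  vertex :> finType;
  adj : rel vertex;
  adj_sym : symmetric adj;
  adj_irr : irreflexive adj
}.

(* Subgraphs are not assumed to be induced. *)
Record subgraph (G : sgraph) := Subgraph {
  sub_verts : {set G};
  sub_adj : rel G;
  sub_adj_sym : symmetric sub_adj;
  sub_adj_sub : forall u v, sub_adj u v ->
    [&& u \in sub_verts, v \in sub_verts & adj u v]
}.

Section Graphs.
Variable G : sgraph.

(* By convention a connected graph is non-empty. *)
Definition connected_subgraph (S : subgraph G) : Prop :=
  sub_verts S != set0 /\
  {in sub_verts S &, forall u v, connect (sub_adj S) u v}.

Definition induced_adj (A : {set G}) : rel G :=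
  fun u v => [&& u \in A, v \in A & adj u v].

Fact induced_adj_sym (A : {set G}) : symmetric (induced_adj A).
Proof. by move=> u v; rewrite /induced_adj adj_sym andbCA. Qed.

Fact induced_adj_sub (A : {set G}) u v :
  induced_adj A u v -> [&& u \in A, v \in A & adj u v].
Proof. by []. Qed.

Definition induced (A : {set G}) : subgraph G :=
  Subgraph (induced_adj_sym A) (@induced_adj_sub A).

End Graphs.

Definition minor (H G : sgraph) : Prop :=
  exists B : H -> subgraph G,
    [/\ forall v, connected_subgraph (B v),
        forall u v, u != v -> [disjoint sub_verts (B u) & sub_verts (B v)]
      & forall u v, adj u v ->
          exists x y, [/\ x \in sub_verts (B u), y \in sub_verts (B v)
                        & adj x y]].

Definition complete_adj (n : nat) : rel 'I_n := fun u v => u != v.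

Fact complete_adj_sym n : symmetric (@complete_adj n).
Proof. by move=> u v; rewrite /complete_adj eq_sym. Qed.

Fact complete_adj_irr n : irreflexive (@complete_adj n).
Proof. by move=> u; rewrite /complete_adj eqxx. Qed.

Definition complete (n : nat) : sgraph :=
  SGraph (@complete_adj_sym n) (@complete_adj_irr n).

Section Nerve.
Variables (T : finType) (n : nat) (F : 'I_n -> {set T}).

(* The empty face always belongs to a simplicial complex; the first disjunct
   only matters when T is empty, as \bigcap over set0 is the whole of T. *)
Definition nerve : {set {set 'I_n}} :=
  [set s : {set 'I_n} | (s == set0) || (\bigcap_(i in s) F i != set0)].

Definition intersecting_triples : {set {set 'I_n}} :=
  [set s in nerve | #|s| == 3].

End Nerve.

(* An induced subgraph is given by its vertex set, so that the intersection of
   the members indexed by s is induced by the intersection of the sets F i. *)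
Definition connected_cover (G : sgraph) (n : nat) (F : 'I_n -> {set G}) : Prop :=
  (forall i, F i != set0) /\
  (forall s, s \in nerve F -> s != set0 ->
     connected_subgraph (induced (\bigcap_(i in s) F i))).

(* Main.v *)
Require Import Defs.
From mathcomp Require Import all_boot all_order all_algebra.
From mathcomp Require Import reals.
From mathcomp Require Import zify.

Set Implicit Arguments.
Unset Strict Implicit.
Unset Printing Implicit Defensive.

(** The theorem is a fractional Helly theorem for the nerve of the cover, viewed
as a simplicial complex on the index set. Three properties of that complex are
extracted from the absence of a [K_5] minor, each by exhibiting a subdivided
[K_5] made of connected intersections ([K5_minor_of_network]), and the rest of
the argument is combinatorial.

- Helly property ([nerve_helly4]): minimal non-faces have at most four elements.
- Cubes ([nerve_cube]): if choosing one set from each of many pairs always gives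
  a face over a base, then some pair as a whole gives a face over that base.
- Boxes ([nerve_box]): if all the rainbow triples of a complete tripartite system
  are faces over a base, then some four-element set is a face over that base.

Boxes make the density climb. A positive proportion of triples contains a
positive proportion of complete tripartite systems, hence gives a positive
proportion of four-element faces, and, applied over bases, a positive proportion
of faces of every fixed size ([dense_faces]).

Cubes forbid a pattern ([rainbow_pattern]): if sufficiently many sets of a fixed
size [k] are given and all their transversals are faces, then one of the sets is
a face. This is proved by merging two elements of the sets at a time; the base is
enlarged until the obstructions to merging no longer depend on the elements chosen
in the remaining sets.

Finally, suppose that there is no face of linear size. By the Helly property each
set of linear size contains linearly many disjoint non-faces of size four, and
since their transversals cannot all be faces, it contains a positive proportion of
non-faces of some fixed size ([many_nonfaces]). Starting from the positive proportion
of faces of a large fixed size, one replaces their elements by such non-faces one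
after the other, each time inside the set of all the possible replacements of the
element ([dense_rainbow]). What results is the forbidden pattern ([large_face]).
The last step follows the way in which fractional Helly theorems are derived from
colourful ones.

Counting is done with sequences, in which repetitions are allowed; densities are
given by natural numbers, the inverses of proportions. *)

(** * Connected sets and [K_5] minors *)

Section Connectivity.
Variable G : sgraph.
Implicit Types A B C D U : {set G}.

Lemma induced_connect_mono A B u v :
  A \subset B -> connect (induced_adj A) u v -> connect (induced_adj B) u v.
Proof.
move=> /subsetP sAB; apply: connect_sub => x y /and3P[xA yA xy].
by apply: connect1; rewrite /induced_adj !sAB.
Qed.

Lemma induced_connect_sym A u v :
  connect (induced_adj A) u v = connect (induced_adj A) v u.
Proof. exact/sym_connect_sym/induced_adj_sym. Qed.

Lemma connect_in_closed (r : rel G) U u v :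
  (forall x y, x \in U -> r x y -> (y \in U) && adj x y) ->
  u \in U -> connect r u v -> v \in U /\ connect (induced_adj U) u v.
Proof.
move=> clU uU /connectP[p]; elim: p u uU => [|x p IHp] u uU /=.
  by move=> _ ->.
case/andP=> rux pth vE; have /andP[xU ux] := clU _ _ uU rux.
have [vU con] := IHp _ xU pth vE; split=> //.
by apply: connect_trans con; apply: connect1; rewrite /induced_adj uU xU.
Qed.

(** A connected set has an edge leaving each of its non-empty proper subsets. *)
Lemma connected_exit D U :
  connected_subgraph (induced D) -> U \subset D -> U != set0 -> U != D ->
  exists x y, [/\ x \in U, y \in D, y \notin U & adj x y].
Proof.
move=> [_ conD] sUD /set0Pn[x xU] neqUD.
have [y yD yU] : exists2 y, y \in D & y \notin U.
  by apply/subsetPn; apply: contraNN neqUD => sDU; rewrite eqEsubset sUD.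
have xy := conD x y (subsetP sUD _ xU) yD.
have [/existsP[u /existsP[v /and4P[]]] | noexit] :=
  boolP [exists u, exists v, [&& u \in U, v \in D, v \notin U & adj u v]].
  by move=> uU vD vU uv; exists u, v.
case/negP: yU; apply: (connect_in_closed _ xU xy).1 => u v uU /and3P[_ vD uv].
rewrite uv andbT; apply: contraNT noexit => vU.
by apply/existsP; exists u; apply/existsP; exists v; apply/and4P.
Qed.

(** A set is connected if it has a connected subset to which each of its vertices
is linked. *)
Lemma connected_attach B C :
  connected_subgraph (induced C) -> C \subset B ->
  (forall v, v \in B -> exists2 c, c \in C & connect (induced_adj B) c v) ->
  connected_subgraph (induced B).
Proof.
move=> [/set0Pn[x xC] conC] sCB att; split.
  by apply/set0Pn; exists x; apply: (subsetP sCB).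
move=> u v /att[c cC cu] /att[d dC dv] /=.
rewrite induced_connect_sym in cu; apply: connect_trans cu _.
by apply: connect_trans dv; apply: induced_connect_mono sCB _; apply: conC.
Qed.

Lemma connected_star (I : finType) (P : pred I) A (B : I -> {set G}) :
  connected_subgraph (induced A) ->
  (forall i, P i -> connected_subgraph (induced (B i)) /\ A :&: B i != set0) ->
  connected_subgraph (induced (A :|: \bigcup_(i | P i) B i)).
Proof.
move=> cA cB; apply: (connected_attach cA (subsetUl _ _)) => v /setUP[vA|].
  by exists v => //; apply: connect0.
case/bigcupP=> i Pi vB; have [[_ con] /set0Pn[x /setIP[xA xB]]] := cB i Pi.
exists x => //; apply: (induced_connect_mono (A := B i)).
  by apply: subsetU; rewrite (bigcup_sup i) ?orbT.
exact: con.
Qed.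

(** ** A sufficient condition for a [K_5] minor

The sets [C i] play the five branch vertices and, for [i < j], the connected
set [D i j] plays the edge between them. Outside the union of
the [C m], the sets [D i j] and [D k l] must be disjoint when [i] and [k] differ;
[D i j] and [D i l] may overlap freely, because the part of [D i j] that is used
goes to the branch set of the smaller index [i]. *)
Section K5.
Variables (C : 'I_5 -> {set G}) (D : 'I_5 -> 'I_5 -> {set G}).
Hypothesis conC : forall i, connected_subgraph (induced (C i)).
Hypothesis conD : forall i j : 'I_5, i < j -> connected_subgraph (induced (D i j)).
Hypothesis disjC : forall i j x, i != j -> x \in C i -> x \in C j -> False.
Hypothesis meetl : forall i j : 'I_5, i < j -> C i :&: D i j != set0.
Hypothesis meetr : forall i j : 'I_5, i < j -> C j :&: D i j != set0.
Hypothesis disjCD : forall (i j k : 'I_5) x, i < j -> k != i -> k != j ->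
  x \in D i j -> x \in C k -> False.
Hypothesis disjD : forall (i j k l : 'I_5) x, i < j -> k < l -> i != k ->
  x \in D i j -> x \in D k l -> exists m, x \in C m.

(** The part of [D i j] that can be reached from [C i] without entering [C j]. *)
Let Z i j := [set v in D i j :\: C j |
  [exists c in C i :&: D i j, connect (induced_adj (D i j :\: C j)) c v]].

(** The branch sets of the minor. *)
Let B i := C i :|: \bigcup_(j : 'I_5 | i < j) Z i j.

Lemma branch_segP i j v : reflect
  (exists2 c, c \in C i :&: D i j & v \in D i j :\: C j /\
     connect (induced_adj (D i j :\: C j)) c v) (v \in Z i j).
Proof.
rewrite [v \in Z i j]in_set; apply: (iffP andP) => [[vD /existsP[c /andP[cC cv]]]|[c cC [vD cv]]].
  by exists c.
by split=> //; apply/existsP; exists c; rewrite cC.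
Qed.

Lemma branch_seg_closed i j x y : x \in Z i j ->
  induced_adj (D i j :\: C j) x y -> (y \in Z i j) && adj x y.
Proof.
move=> /branch_segP[c cC [xD cx]] xy; have /and3P[_ yD ->] := xy.
rewrite andbT; apply/branch_segP; exists c => //; split=> //.
exact: connect_trans cx (connect1 xy).
Qed.

Lemma branch_seg_root (i j : 'I_5) c : i < j -> c \in C i :&: D i j -> c \in Z i j.
Proof.
move=> ij cCD; apply/branch_segP; exists c => //; split; last exact: connect0.
case/setIP: cCD => cC cD; rewrite inE cD andbT; apply/negP=> cCj.
by apply: (disjC _ cC cCj); rewrite neq_ltn ij.
Qed.

Lemma branch_seg_disj (i j k : 'I_5) x : i < j -> k != i -> x \in Z i j -> x \notin C k.
Proof.
move=> ij ki /branch_segP[c _ [/setDP[xD xC] _]].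
have [->//|kj] := eqVneq k j.
by apply/negP => xk; apply: (disjCD ij ki kj xD xk).
Qed.

Lemma branch_disj i k x : i != k -> x \in B i -> x \in B k -> False.
Proof.
move=> ik /setUP[xi|/bigcupP[j ij xZ]] /setUP[xk|/bigcupP[l kl xZ']].
- exact: (disjC ik xi xk).
- by move: xi; apply/negP; apply: (branch_seg_disj kl ik xZ').
- by move: xk; apply/negP; apply: (branch_seg_disj ij _ xZ); rewrite eq_sym.
have [c _ [/setDP[xD _] _]] := branch_segP _ _ _ xZ.
have [c' _ [/setDP[xD' _] _]] := branch_segP _ _ _ xZ'.
have [m xm] := disjD ij kl ik xD xD'.
have [mi|mi] := eqVneq m i; last by move: xm; apply/negP; apply: (branch_seg_disj ij mi xZ).
by move: xm; apply/negP; apply: (branch_seg_disj kl _ xZ'); rewrite mi.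
Qed.

(** An edge leaving [Z i j] inside [D i j] can only end in [C j]. *)
Lemma branch_adj (i j : 'I_5) : i < j ->
  exists x y, [/\ x \in B i, y \in B j & adj x y].
Proof.
move=> ij.
have [x [y [xZ yD yZ xy]]] : exists x y,
    [/\ x \in Z i j, y \in D i j, y \notin Z i j & adj x y].
  apply: connected_exit (conD ij) _ _ _.
  - by apply/subsetP=> v /branch_segP[c _ [/setDP[]]].
  - have /set0Pn[c cCD] := meetl ij.
    by apply/set0Pn; exists c; apply: branch_seg_root.
  have /set0Pn[c /setIP[cC cD]] := meetr ij.
  apply: contraTneq cD => <-; apply/negP=> cZ.
  by move: cC; apply/negP; apply: (branch_seg_disj ij _ cZ); rewrite neq_ltn ij orbT.
exists x, y; split=> //.
  by apply/setUP; right; apply/bigcupP; exists j.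
have [yC|yC] := boolP (y \in C j); first by apply/setUP; left.
have [c cCD [xD cx]] := branch_segP _ _ _ xZ.
case/negP: yZ; have := @branch_seg_closed i j x y xZ.
by rewrite /induced_adj xD inE yC yD xy => /(_ isT)/andP[].
Qed.

Lemma branch_conn i : connected_subgraph (induced (B i)).
Proof.
apply: (connected_attach (conC i) (subsetUl _ _)) => v /setUP[vC|].
  by exists v => //; apply: connect0.
case/bigcupP=> j ij vZ; have [c cCD [vD cv]] := branch_segP _ _ _ vZ.
exists c; first by case/setIP: cCD.
apply: (induced_connect_mono (A := Z i j)).
  by apply: subsetU; rewrite (bigcup_sup j) ?orbT.
exact: (connect_in_closed (@branch_seg_closed i j) (branch_seg_root ij cCD) cv).2.
Qed.

Lemma K5_minor_of_network : minor (complete 5) G.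
Proof.
exists (fun i : complete 5 => induced (B i)); split.
- exact: branch_conn.
- move=> i j ij; rewrite -setI_eq0; apply/eqP/setP=> x.
  by rewrite in_setI in_set0; apply/negP=> /andP[]; apply: branch_disj.
move=> i j ij; have [lij|] := boolP (i < j); first exact: branch_adj.
rewrite -leqNgt leq_eqVlt => /predU1P[/val_inj eji|lji].
  by move: ij; rewrite /adj /= /complete_adj eji eqxx.
have [x [y [xB yB xy]]] := branch_adj lji.
by exists y, x; rewrite adj_sym.
Qed.

End K5.
End Connectivity.

(** * The nerve of a connected cover *)

(** The vertices and the edges of a subdivided [K_5]; among the pairs [(i, j)]
only those with [i < j] are used as edges. *)
Definition network_node : finType := ('I_5 + 'I_5 * 'I_5)%type.

(** The vertices [a i], [b j] and [c p] of the parts, of sizes 5, 5 and 25, of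
a complete tripartite system of triples. *)
Definition box_position : finType := ('I_5 + 'I_5 + 'I_5 * 'I_5)%type.

Section Cover.
Variables (G : sgraph) (n : nat) (F : 'I_n -> {set G}).
Hypothesis noK5 : ~ minor (complete 5) G.
Hypothesis coverF : connected_cover F.

Local Notation face S := (S \in nerve F).
Implicit Types S T : {set 'I_n}.
(** The common part of the members indexed by [S]; it is the whole graph when
[S] is empty, hence possibly disconnected then. *)
Let Y (S : {set 'I_n}) := \bigcap_(i in S) F i.

Lemma faceE (S : {set 'I_n}) : S != set0 -> face S = (Y S != set0).
Proof. by rewrite inE => /negPf ->. Qed.

Lemma cell_mono (S T : {set 'I_n}) : S \subset T -> Y T \subset Y S.
Proof.
move=> /subsetP sST; apply/subsetP=> v /bigcapP vT.
by apply/bigcapP=> i /sST; apply: vT.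
Qed.

Lemma cellU (S T : {set 'I_n}) v : v \in Y S -> v \in Y T -> v \in Y (S :|: T).
Proof.
move=> /bigcapP vS /bigcapP vT; apply/bigcapP=> i /setUP[]; [exact: vS|exact: vT].
Qed.

Lemma face_cell S v : v \in Y S -> face S.
Proof.
by move=> vS; rewrite inE; apply/orP; right; apply/set0Pn; exists v.
Qed.

Lemma face_down S T : S \subset T -> face T -> face S.
Proof.
move=> sST fT; have [->|S0] := eqVneq S set0; first by rewrite inE eqxx.
have T0 : T != set0 by apply: contraNneq S0 => T0; rewrite -subset0 -T0.
move: fT; rewrite faceE // => /set0Pn[v vT].
exact: face_cell (subsetP (cell_mono sST) _ vT).
Qed.

Lemma cell_conn S : S != set0 -> face S -> connected_subgraph (induced (Y S)).
Proof. by move=> S0 fS; apply: coverF.2. Qed.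

Lemma cell_neq0 S : S != set0 -> face S -> exists v, v \in Y S.
Proof. by move=> S0; rewrite faceE // => /set0Pn. Qed.

Lemma face1 i : face [set i].
Proof.
rewrite inE; apply/orP; right; have /set0Pn[v vF] := coverF.1 i.
by apply/set0Pn; exists v; apply/bigcapP => j /set1P ->.
Qed.

(** The Helly property. If a minimal non-face [T] has at least five elements
[e 0 .. e 4], the sets [Y (T :\ e i)] are pairwise disjoint and joined by the
sets [Y (T :\ e i :\ e j)]. *)
Lemma nerve_helly4 S : ~~ face S -> exists T : {set 'I_n}, [/\ T \subset S, ~~ face T & #|T| <= 4].
Proof.
move=> nS; have [T /minsetP[nT minT] sTS] := minset_exists (P := [pred U | ~~ face U]) nS.
exists T; split=> //; rewrite leqNgt; apply/negP => T5; apply: noK5.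
pose e (i : 'I_5) := enum_val (widen_ord T5 i).
have eT i : e i \in T by apply: enum_valP.
have eI : injective e.
  by move=> i j /enum_val_inj/(congr1 val)/= ij; apply: val_inj.
have nY v : v \in Y T -> False by move=> /face_cell; apply/negP.
have fT (U : {set 'I_n}) i : U \subset T :\ e i -> face U.
  move=> sU; apply: contraTT isT => nU.
  have sUT : U \subset T by apply: subset_trans sU (subsetDl _ _).
  by have := subsetP sU (e i); rewrite (minT _ nU sUT) eT !inE eqxx => /(_ isT).
have ne (i j : 'I_5) : T :\ e i :\ e j != set0.
  apply/set0Pn.
  have [k /andP[ki kj]] : exists k : 'I_5, (k != i) && (k != j).
    apply/existsP; apply: contraTT isT => /existsPn h.
    have: #|'I_5| <= #|[set i; j]|.
      rewrite -cardsT; apply: subset_leq_card; apply/subsetP=> k _.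
      by have := h k; rewrite !inE negb_and !negbK.
    by rewrite cards2 card_ord; case: (i != j).
  by exists (e k); rewrite !inE eT !(inj_eq eI) ki kj.
have ne1 i : T :\ e i != set0.
  by apply: contraNneq (ne i i) => ->; rewrite set0D.
apply: (@K5_minor_of_network G (fun i => Y (T :\ e i))
  (fun i j => Y (T :\ e i :\ e j))).
- by move=> i; apply: cell_conn => //; apply: (fT _ i).
- by move=> i j _; apply: cell_conn => //; apply: (fT _ i); apply: subsetDl.
- move=> i j v ij vi vj; apply: (nY v).
  apply: subsetP (cell_mono _) _ (cellU vi vj).
  apply/subsetP=> x xT; rewrite !inE xT !andbT -negb_and.
  by apply/negP=> /andP[/eqP -> /eqP/eI ijE]; rewrite ijE eqxx in ij.
- move=> i j _; have [v v1] := cell_neq0 (ne1 i) (fT _ i (subxx _)).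
  apply/set0Pn; exists v; rewrite inE v1.
  exact: subsetP (cell_mono (subsetDl _ _)) _ v1.
- move=> i j _; have [v v1] := cell_neq0 (ne1 j) (fT _ j (subxx _)).
  apply/set0Pn; exists v; rewrite inE v1.
  by apply: subsetP (cell_mono _) _ v1; apply/setSD/subsetDl.
- move=> i j k v _ ki kj vD vC; apply: (nY v).
  apply: subsetP (cell_mono _) _ (cellU vD vC).
  apply/subsetP=> x xT; rewrite !inE xT !andbT.
  by have [->|] := eqVneq x (e k); rewrite ?orbT // !(inj_eq eI) ki kj.
move=> i j k l v ij kl ik vD vD'.
(* v lies in all the members indexed by T, except possibly the one indexed by
   e m, which is the only element that {e i, e j} and {e k, e l} can share *)
have vU := cellU vD vD'.
pose m := if l == i then i else j; exists m.
apply: subsetP (cell_mono _) _ vU; apply/subsetP=> x; rewrite !inE => /andP[xm xT].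
rewrite xT !andbT -!negb_or -negb_and; apply: contraNN xm.
rewrite /m => /andP[/orP[]/eqP-> /orP[]]; rewrite !(inj_eq eI).
- move=> /eqP jl; have [li|//] := eqVneq l i.
  by move: jl ij; rewrite li => ->; rewrite ltnn.
- move=> /eqP jk; have [li|//] := eqVneq l i.
  by move: ij kl; rewrite jk li => a /(ltn_trans a); rewrite ltnn.
- by move=> /eqP il; rewrite il eqxx.
by rewrite (negPf ik).
Qed.

(** ** Cubes of faces

Given pairs [(x j, y j)] indexed by the ordered pairs of nodes of a subdivided
[K_5], such that the base [b] together with one set from each pair is always a
face, one of the unions [b :|: x j :|: y j] is a face. Otherwise one builds a
partial word [S s] for each node [s]: at the coordinate [(s, t)] the words of
[s] and [t] disagree when the nodes must be represented by disjoint sets. *)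
Section Cube.
Local Notation T := network_node.
Variables (b : {set 'I_n}) (x y : T * T -> {set 'I_n}).
Hypothesis words_face : forall w : T * T -> bool,
  face (b :|: \bigcup_j (if w j then y j else x j)).

(** The pairs of nodes whose sets must be disjoint. *)
Let conflict (s t : T) : bool :=
  match s, t with
  | inl i, inl j => i != j
  | inl k, inr p | inr p, inl k => (k != p.1) && (k != p.2)
  | inr p, inr q => p.1 != q.1
  end.

Let conflict_sym : symmetric conflict.
Proof. by case=> [i|p] [j|q] //=; rewrite eq_sym. Qed.

Let conflict_irr : irreflexive conflict.
Proof. by case=> [i|p] /=; rewrite eqxx. Qed.

Let S s := b :|: \bigcup_(t | conflict s t) (x (s, t) :|: y (t, s)).

Let compat_face s t : ~~ conflict s t -> face (S s :|: S t).
Proof.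
move=> nst.
(* the word that follows S s and S t wherever one of them is defined *)
pose w (j : T * T) := ((j.2 == s) || (j.2 == t)) && conflict j.1 j.2.
have sS r : (r == s) || (r == t) ->
    S r \subset b :|: \bigcup_j (if w j then y j else x j).
  move=> rst; apply/subUsetP; split; first exact: subsetUl.
  apply/bigcupsP=> u ru; apply: subsetU; apply/orP; right.
  apply/subUsetP; split; last first.
    apply: (bigcup_max (u, r)) => //.
    by rewrite /w /= rst conflict_sym ru.
  apply: (bigcup_max (r, u)) => //; rewrite /w /= ru andbT.
  case: ifP => //; case/orP: rst ru => /eqP-> ru /orP[]/eqP uE;
    by rewrite uE ?conflict_irr ?(negPf nst) 1?conflict_sym ?(negPf nst) in ru.
apply: face_down (words_face w); apply/subUsetP; split; apply: sS.
  by rewrite eqxx.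
by rewrite eqxx orbT.
Qed.

Lemma nerve_cube : exists j, face (b :|: x j :|: y j).
Proof.
apply/existsP; apply: contraT => /existsPn nf; case: noK5.
(* if x j were empty, b :|: y j, part of a word, would be the forbidden union *)
have x_neq0 j : x j != set0.
  apply: contraNneq (nf j) => ->; rewrite setU0.
  apply: face_down (words_face xpredT); apply: setUS.
  exact: (bigcup_max j).
have disj s t v : conflict s t -> v \in Y (S s) -> v \in Y (S t) -> False.
  move=> st vs vt; have /negP[] := nf (s, t).
  apply: face_down (face_cell (cellU vs vt)).
  apply/subUsetP; split; first (apply/subUsetP; split).
  - by rewrite -setUA subsetUl.
  - apply/subsetU/orP; left; apply/subsetU/orP; right.
    by apply: (bigcup_max t) => //; apply: subsetUl.
  apply/subsetU/orP; right; apply/subsetU/orP; right.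
  by apply: (bigcup_max s); rewrite 1?conflict_sym // subsetUr.
have S_neq0 s : S s != set0.
  have [t st] : exists t, conflict s t.
    pose o (i : 'I_5) : 'I_5 := if i == ord0 then ord_max else ord0.
    have io i : i != o i by rewrite /o; have [->|] := eqVneq i ord0.
    by case: s => [i|p]; [exists (inl (o i)) | exists (inr (o p.1, p.1))]; apply: io.
  have /set0Pn[z zx] := x_neq0 (s, t).
  apply/set0Pn; exists z; apply/setUP; right; apply/bigcupP; exists t => //.
  by apply/setUP; left.
have S_face s : face (S s).
  by have := @compat_face s s; rewrite conflict_irr setUid => ->.
have meet s t : ~~ conflict s t -> Y (S s) :&: Y (S t) != set0.
  move=> st; have [|v vU] := cell_neq0 _ (compat_face st).
    by apply: contraNneq (S_neq0 s) => U0; rewrite -subset0 -U0 subsetUl.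
  apply/set0Pn; exists v; apply/setIP.
  by split; apply: subsetP (cell_mono _) _ vU; rewrite ?subsetUl ?subsetUr.
apply: (@K5_minor_of_network G (fun i => Y (S (inl i)))
  (fun i j => Y (S (inr (i, j))))).
- by move=> i; apply: cell_conn.
- by move=> i j _; apply: cell_conn.
- by move=> i j v ij; apply: disj.
- by move=> i j _; apply: meet; rewrite /= eqxx.
- by move=> i j _; apply: meet; rewrite /= eqxx andbF.
- by move=> i j k v _ ki kj; apply: disj; rewrite /= ki kj.
by move=> i j k l v _ _ ik vD vD'; case: (disj _ _ _ _ vD vD').
Qed.

End Cube.

(** ** Boxes of faces

If all rainbow triples of a complete tripartite system are faces over a base
[e], then four distinct positions form a face over [e]. Otherwise the cells of
two pairs of positions are disjoint unless the pairs share a position, and the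
five branch vertices are the cells of [(a i, b i)]; the [i]-th and the [j]-th
are joined inside the layer [c (i, j)], first along [(a i, c (i, j))] and then
along [(b j, c (i, j))]. The latter segment is made part of the [j]-th branch
vertex. *)
Section Box.
Local Notation Pos := box_position.
Variables (e : {set 'I_n}) (g : Pos -> 'I_n).
Let a i : Pos := inl (inl i).
Let b i : Pos := inl (inr i).
Let c p : Pos := inr p.
Hypothesis box_face : forall i j p, face (e :|: [set g (a i); g (b j); g (c p)]).

Lemma nerve_box : exists s1 s2 s3 s4 : Pos, uniq [:: s1; s2; s3; s4] /\
  face (e :|: [set g s1; g s2; g s3; g s4]).
Proof.
have [/existsP[s1 /existsP[s2 /existsP[s3 /existsP[s4 /andP[]]]]]|no4] :=
  boolP [exists s1, exists s2, exists s3, exists s4 : Pos,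
    uniq [:: s1; s2; s3; s4] && face (e :|: [set g s1; g s2; g s3; g s4])].
  by exists s1, s2, s3, s4.
case: noK5.
pose P s t := e :|: [set g s; g t].
have inP s t v : v \in Y (P s t) -> [/\ v \in Y e, v \in F (g s) & v \in F (g t)].
  move=> vY; split.
  - by apply: subsetP (cell_mono (subsetUl _ _)) _ vY.
  - by move/bigcapP: vY; apply; rewrite !inE eqxx orbT.
  by move/bigcapP: vY; apply; rewrite !inE eqxx !orbT.
(* no vertex lies in the base and in members at four distinct positions *)
have disj s1 s2 s3 s4 v : uniq [:: s1; s2; s3; s4] ->
    v \in Y (P s1 s2) -> v \in Y (P s3 s4) -> False.
  move=> us /inP[ve v1 v2] /inP[_ v3 v4]; case/negP: no4.
  apply/existsP; exists s1; apply/existsP; exists s2.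
  apply/existsP; exists s3; apply/existsP; exists s4; rewrite us /=.
  apply: (face_cell (v := v)); apply: cellU ve _.
  by apply/bigcapP => i; rewrite !inE -!orbA => /or4P[]/eqP->.
have P0 s t : P s t != set0.
  by apply/set0Pn; exists (g s); rewrite !inE eqxx orbT.
have common i j p : exists v,
    [/\ v \in Y (P (a i) (b j)), v \in Y (P (a i) (c p)) & v \in Y (P (b j) (c p))].
  have [|v vY] := cell_neq0 _ (box_face i j p).
    by apply/set0Pn; exists (g (a i)); rewrite !inE eqxx orbT.
  exists v; split; apply: subsetP (cell_mono (setUS _ _)) _ vY;
    apply/subsetP => z; rewrite !inE => /orP[]->; rewrite ?orbT //.
have connab i j : connected_subgraph (induced (Y (P (a i) (b j)))).
  by have [v [/face_cell vf _ _]] := common i j (i, j); apply: cell_conn.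
have connac i p : connected_subgraph (induced (Y (P (a i) (c p)))).
  by have [v [_ /face_cell vf _]] := common i i p; apply: cell_conn.
have connbc i p : connected_subgraph (induced (Y (P (b i) (c p)))).
  by have [v [_ _ /face_cell vf]] := common i i p; apply: cell_conn.
pose C i := Y (P (a i) (b i)) :|: \bigcup_(j : 'I_5 | j < i) Y (P (b i) (c (j, i))).
have inC i v : v \in C i -> v \in Y (P (a i) (b i)) \/
    exists2 j : 'I_5, j < i & v \in Y (P (b i) (c (j, i))).
  case/setUP=> [|/bigcupP[j ji]]; first by left.
  by right; exists j.
apply: (@K5_minor_of_network G C (fun i j => Y (P (a i) (c (i, j))))).
- move=> i; apply: connected_star => // j _; split=> //.
  have [v [v1 _ v2]] := common i i (j, i).
  by apply/set0Pn; exists v; apply/setIP.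
- by move=> i j _; apply: connac.
- move=> i j v ij /inC[vi|[k _ vi]] /inC[vj|[l _ vj]]; apply: (disj _ _ _ _ _ _ vi vj);
    by rewrite /= !inE /eq_op /= /eq_op /= ?xpair_eqE ?(negPf ij) ?andbF ?orbF.
- move=> i j ij; have [v [v1 v2 _]] := common i i (i, j).
  by apply/set0Pn; exists v; rewrite !inE v1 v2.
- move=> i j ij; have [v [_ v1 v2]] := common i j (i, j).
  apply/set0Pn; exists v; apply/setIP; split=> //; apply/setUP; right.
  by apply/bigcupP; exists i.
- move=> i j k v ij ki kj vD /inC[vC|[l _ vC]]; apply: (disj _ _ _ _ _ _ vD vC);
    rewrite /= !inE /eq_op /= /eq_op /= ?xpair_eqE.
    by rewrite [i == k]eq_sym (negPf ki).
  by rewrite [j == k]eq_sym (negPf kj) andbF.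
move=> i j k l v _ _ ik vD vD'; case: (disj _ _ _ _ _ _ vD vD').
by rewrite /= !inE /eq_op /= /eq_op /= ?xpair_eqE (negPf ik).
Qed.

End Box.
End Cover.

(** * Words and the forbidden pattern *)

Section Words.
Variable V : finType.
Implicit Types (P Q R : seq (seq {set V})) (r : seq {set V}) (a e u v w : {set V}).

(** The rows of [P] list the letters allowed at each coordinate; a word is the
union of one letter from each row. *)
Fixpoint words P : seq {set V} :=
  if P is r :: P' then [seq a :|: u | a <- r, u <- words P'] else [:: set0].

Lemma words_consP r P u :
  reflect (exists a v, [/\ a \in r, v \in words P & u = a :|: v])
          (u \in words (r :: P)).
Proof.
apply: (iffP allpairsP) => [[[a v] /= []]|[a [v [ar vP ->]]]]; first by exists a, v.
by exists (a, v).
Qed.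

Lemma words_cat P Q u v :
  u \in words P -> v \in words Q -> u :|: v \in words (P ++ Q).
Proof.
elim: P u => [|r P IHP] u; first by rewrite inE => /eqP-> /=; rewrite set0U.
case/words_consP=> a [u' [ar uP ->]] vQ; rewrite -setUA.
by apply/words_consP; exists a, (u' :|: v); split=> //; apply: IHP.
Qed.

Lemma words_subseq P Q u : all (fun r => r != [::]) Q -> subseq P Q ->
  u \in words P -> exists2 v, v \in words Q & u \subset v.
Proof.
elim: Q P u => [|r Q IHQ] P u /=; first by case: P => // _ _; exists u.
case/andP; case: r => // a r _ neQ.
case: P => [|r' P] sPQ.
  rewrite inE => /eqP->.
  have [v vQ _] := IHQ [::] set0 neQ (sub0seq _) (mem_head _ _).
  exists (a :|: v); last exact: sub0set.
  by apply/(words_consP (a :: r) Q); exists a, v; rewrite mem_head.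
move: sPQ => /=; case: eqP => [-> sPQ /words_consP[a' [v' [ar vP ->]]]|_ sPQ uP].
  have [v vQ sv] := IHQ P v' neQ sPQ vP.
  exists (a' :|: v); last exact: setUS.
  by apply/(words_consP (a :: r) Q); exists a', v.
have [v vQ sv] := IHQ _ _ neQ sPQ uP.
exists (a :|: v); first by apply/(words_consP (a :: r) Q); exists a, v; rewrite mem_head.
exact: subset_trans sv (subsetUr _ _).
Qed.

Lemma words_letters P (f : nat -> bool) : all (fun r => 1 < size r) P ->
  exists2 u, u \in words P &
    forall i, i < size P -> nth set0 (nth [::] P i) (f i) \subset u.
Proof.
elim: P f => [|r P IHP] f /=; first by exists set0; rewrite ?inE.
case/andP=> r2 /(IHP (f \o succn))[v vP fv].
exists (nth set0 r (f 0) :|: v).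
  apply/words_consP; exists (nth set0 r (f 0)), v; split=> //.
  by apply: mem_nth; apply: leq_ltn_trans r2; apply: leq_b1.
case=> [|i] iP; first exact: subsetUl.
exact: subset_trans (fv i iP) (subsetUr _ _).
Qed.

Lemma count_ltn (X : eqType) (s : seq X) (p q : pred X) x :
  subpred p q -> x \in s -> q x -> ~~ p x -> count p s < count q s.
Proof.
move=> spq xs qx npx; elim: s xs => //= y s IHs; rewrite inE => /predU1P[<-|/IHs].
  by rewrite qx (negPf npx) ltnS; apply: sub_count.
by move=> lt_pq; rewrite -addnS leq_add //; case: (boolP (p y)) => // /spq ->.
Qed.

(** Let monotone properties [Bd x], for [x] in [s], be given. After replacing
[u0] by [u0 :|: v] for a word [v] over some rows, no word over [L] further rows
makes a new property hold: each failure to stabilise makes at least one more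
property true, which happens at most [D] times. *)
Lemma stabilize (X : eqType) (s : seq X) (Bd : X -> pred {set V}) D L P u0 :
  (forall x u v, u \subset v -> Bd x u -> Bd x v) ->
  count (fun x => ~~ Bd x u0) s <= D -> D.+1 * L <= size P ->
  exists v P1 P2 P3, [/\ P = P1 ++ P2 ++ P3, size P2 = L, v \in words P1 &
    forall w x, w \in words P2 -> x \in s ->
      Bd x (u0 :|: v :|: w) -> Bd x (u0 :|: v)].
Proof.
move=> Bmono; elim: D P u0 => [|D IHD] P u0 cD sP;
  have [/hasP[w wP /hasP[x xs /andP[Bw nB]]]|nh] := boolP (has (fun w =>
    has (fun x => Bd x (u0 :|: w) && ~~ Bd x u0) s) (words (take L P)));
  try by exists set0, [::], (take L P), (drop L P);
    split; rewrite ?inE ?cat_take_drop // ?size_takel //; [lia|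
    move=> w x wP xs; rewrite setU0; apply: contraTT => nB; apply: contraNN nh => Bw;
    apply/hasP; exists w => //; apply/hasP; exists x; rewrite ?Bw].
  by move: cD; rewrite leqn0 eqn0Ngt -has_count; case/hasP; exists x.
have [||v [P1 [P2 [P3 [eP sP2 vP1 st]]]]] := IHD (drop L P) (u0 :|: w).
- rewrite -ltnS; apply: leq_trans cD; apply: (count_ltn _ xs nB); last by rewrite Bw.
  by move=> y; apply: contraNN; apply/Bmono/subsetUl.
- by rewrite size_drop; lia.
exists (w :|: v), (take L P ++ P1), P2, P3; split=> //.
- by rewrite -catA -eP cat_take_drop.
- exact: words_cat.
by rewrite setUA.
Qed.

End Words.

(** The condition defining abstract simplicial complexes; [K] may be empty. *)
Definition down_closed (V : finType) (K : pred {set V}) :=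
  forall S T : {set V}, S \subset T -> K T -> K S.

(** If choosing one set from each of the pairs [(x j, y j)] always gives a face
over [b], then some pair as a whole gives a face over [b]. *)
Definition cube_closed (J V : finType) (K : pred {set V}) :=
  forall (b : {set V}) (x y : J -> {set V}),
    (forall w : J -> bool, K (b :|: \bigcup_j (if w j then y j else x j))) ->
    exists j, K (b :|: x j :|: y j).

(** The number of rows of [k.+2] letters sufficient to obtain [m] rows whose
first two letters are merged, over [N] base faces, when cubes of dimension [c]
are controlled. *)
Fixpoint merge_size (c k m N : nat) : nat :=
  if m is m'.+1 then
    (N * c).+1 + (N * (N * c).+1).+1 * merge_size c k m' (N * k.+1)
  else 0.

(** The number of rows of [k.+1] letters sufficient for [rainbow_pattern]. *)
Fixpoint pattern_size (c k : nat) : nat :=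
  if k is k'.+1 then merge_size c k' (pattern_size c k') 1 else 1.

Section Patterns.
Variables (J V : finType) (K : pred {set V}).
Hypotheses (downK : down_closed K) (cubeK : cube_closed J K).
Implicit Types (E r : seq {set V}) (P Q : seq (seq {set V})) (e u v S : {set V}).
Local Notation c := #|J|.

(** All words over [P] are faces over each base in [E]. *)
Definition good E P := forall e u, e \in E -> u \in words P -> K (e :|: u).

(** Replaces the first two letters of a row by their union. *)
Definition merge_top r := (nth set0 r 0 :|: nth set0 r 1) :: drop 2 r.

Lemma good_face E P P' e u (S : {set V}) : good E P -> all (fun r => r != [::]) P ->
  subseq P' P -> e \in E -> u \in words P' -> S \subset e :|: u -> K S.
Proof.
move=> gEP neP sP eE /(words_subseq neP sP)[v vP uv] sS.
by apply: downK (gEP e v eE vP); apply: subset_trans sS (setUS _ uv).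
Qed.

(** [cube_closed] for the first two letters of the rows of [P]. *)
Lemma cube_rows b P : c <= size P -> all (fun r => 1 < size r) P ->
  (forall u, u \in words P -> K (b :|: u)) ->
  exists2 r, r \in P & K (b :|: (nth set0 r 0 :|: nth set0 r 1)).
Proof.
move=> cP P2 KP; pose row (j : J) := nth [::] P (enum_rank j).
have rowP j : enum_rank j < size P := leq_trans (ltn_ord _) cP.
have [w|j Kj] := @cubeK b (fun j => nth set0 (row j) 0) (fun j => nth set0 (row j) 1).
  pose f i := if @insub nat (fun i => i < c) 'I_c i is Some k then w (enum_val k)
              else false.
  have [u uP fu] := words_letters f P2.
  apply: downK (KP u uP); apply/setUS/bigcupsP=> j _.
  have := fu _ (rowP j); rewrite /f valK enum_rankK.
  by case: (w j).
by exists (row j); [apply: mem_nth | rewrite setUA].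
Qed.

(** One row whose first two letters can be merged. Call a row [r] of a block [R]
bad for [e] when its merged letter is not a face over [e]; the base is first
enlarged until no word over [L] of the remaining rows makes another row bad.
For each [e] at most [c] rows are bad, because a cube of dimension [c] would
be missing otherwise, so that a large block contains a row good for all [e]. *)
Lemma merge_step E P N L k : size E <= N ->
  (N * c).+1 + (N * (N * c).+1).+1 * L <= size P ->
  all (fun r => size r == k.+2) P -> good E P ->
  exists r v Q, [/\ r \in P, {subset Q <= P}, size Q = L &
    good [seq e :|: v :|: a | e <- E, a <- merge_top r] Q].
Proof.
set h := (N * c).+1 => EN sP Pk gEP.
have Pne : all (fun r => r != [::]) P.
  by apply: sub_all Pk => r; rewrite -size_eq0 => /eqP->.
have P2 : all (fun r => 1 < size r) P by apply: sub_all Pk => r /eqP->.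
pose R := take h P; pose top r := nth set0 r 0 :|: nth set0 r 1.
have sR : size R = h by rewrite size_takel //; lia.
pose Bd (x : {set V} * seq {set V}) u := ~~ K (x.1 :|: u :|: top x.2).
have Bmono x u v : u \subset v -> Bd x u -> Bd x v.
  by move=> uv; apply: contraNN; apply: downK; apply/setSU/setUS.
have [||v [Q1 [Q2 [Q3 [eQ sQ2 vQ1 st]]]]] := @stabilize _ _ [seq (e, r) | e <- E, r <- R]
    Bd (N * h) L (drop h P) set0 Bmono.
- apply: leq_trans (count_size _ _) _; rewrite size_allpairs sR.
  by rewrite leq_mul2r EN orbT.
- by rewrite size_drop; lia.
have eP : P = R ++ Q1 ++ Q2 ++ Q3 by rewrite -eQ cat_take_drop.
have RP r : r \in R -> r \in P by rewrite eP mem_cat => ->.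
have [r rR Kr] : exists2 r, r \in R & forall e, e \in E -> K (e :|: v :|: top r).
  have [/hasP[r rR /allP Kr]|/hasPn nr] := boolP (has (fun r =>
    all (fun e => K (e :|: v :|: top r)) E) R); first by exists r.
  have cbad e : e \in E -> count (fun r => ~~ K (e :|: v :|: top r)) R <= c.
    move=> eE; rewrite leqNgt -size_filter; apply/negP => big.
    set B := filter _ R in big.
    have [|u uB|r] := @cube_rows (e :|: v) B (ltnW big).
    - by apply/allP=> r; rewrite mem_filter => /andP[_ /RP/(allP P2)].
    - apply: (good_face (P' := B ++ Q1) (u := u :|: v) gEP Pne _ eE).
      + rewrite eP; apply: cat_subseq (filter_subseq _ _) _; exact: prefix_subseq.
      + exact: words_cat.
      by rewrite -setUA (setUC v).
    by rewrite mem_filter => /andP[/negP].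
  suff: size R <= size E * c.
    rewrite sR => /leq_trans/(_ (leq_mul EN (leqnn _))); lia.
  have: all (fun r => has (fun e => ~~ K (e :|: v :|: top r)) E) R.
    by apply/allP=> r /nr; rewrite -has_predC.
  elim: (E) (R) cbad => [|e E' IHE] R' cb aR /=.
    by case: R' aR {cb}.
  rewrite mulSn -(count_predC (fun r => ~~ K (e :|: v :|: top r)) R').
  rewrite leq_add ?cb ?mem_head // -size_filter; apply: IHE.
    move=> e' e'E; apply: leq_trans (cb e' _); last by rewrite inE e'E orbT.
    by rewrite count_filter; apply: sub_count => x /andP[].
  apply/allP=> x; rewrite mem_filter => /andP[/= nx xR].
  by have /= := allP aR x xR; rewrite (negPf nx).
exists r, v, Q2; split=> //; first exact: RP.
  by move=> x xQ; rewrite eP !mem_cat xQ !orbT.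
move=> _ u /allpairsP[[e a] /= [eE + ->]] uQ; rewrite inE => /predU1P[->|ar].
  have := st u (e, r) uQ; rewrite allpairs_f // => /(_ isT).
  rewrite /Bd /= set0U; move/contraLR/(_ (Kr e eE)).
  by rewrite (setUAC _ _ u) -!(setUA e).
have {}ar := mem_drop ar.
apply: (good_face (P' := [:: r] ++ Q1 ++ Q2) (u := a :|: (v :|: u)) gEP Pne _ eE).
- rewrite eP; apply: cat_subseq; first by rewrite sub1seq.
  by apply: cat_subseq (subseq_refl _) _; apply: prefix_subseq.
- apply: words_cat; last exact: words_cat.
  by apply/words_consP; exists a, set0; rewrite inE setU0.
by rewrite -!setUA; apply: setUS; rewrite !setUA (setUC v).
Qed.

(** Merging in [m] rows at once: each row found by [merge_step] is absorbed,
letter by letter, into the list of bases. *)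
Lemma merge_rows k m N E P : size E <= N -> merge_size c k m N <= size P ->
  all (fun r => size r == k.+2) P -> good E P ->
  exists v Q, [/\ {subset Q <= P}, size Q = m &
    good [seq e :|: v | e <- E] (map merge_top Q)].
Proof.
elim: m N E P => [|m IHm] N E P EN sP Pk gEP.
  exists set0, [::]; split=> // _ u /mapP[e eE ->]; rewrite inE => /eqP->.
  apply: (good_face (P' := [::]) gEP _ (sub0seq _) eE (mem_head _ _)).
    by apply: sub_all Pk => r; rewrite -size_eq0 => /eqP->.
  by rewrite setU0.
have [r [v [Q [rP QP sQ gQ]]]] := merge_step EN sP Pk gEP.
have [|||v' [Q' [Q'Q sQ' gQ']]] := IHm (N * k.+1) _ Q _ _ _ gQ.
- rewrite size_allpairs /= size_drop; have /eqP-> := allP Pk r rP.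
  by rewrite subn2 leq_mul.
- by rewrite sQ.
- by apply/allP=> x /QP/(allP Pk).
exists (v :|: v'), (r :: Q'); split=> /=; last first.
- move=> _ u /mapP[e eE ->] /words_consP[a [w [ar wQ ->]]].
  have := gQ' (e :|: v :|: a :|: v') w (map_f _ (allpairs_f _ eE ar)) wQ.
  by apply: downK; rewrite -!setUA; do 2!apply: setUS; rewrite !setUA (setUC v').
- by rewrite sQ'.
by move=> x; rewrite inE => /predU1P[->//|/Q'Q/QP].
Qed.

(** In a large system of rows all of whose words are faces, the union of the
letters of some row is a face. *)
Lemma rainbow_pattern k e P : pattern_size c k <= size P ->
  all (fun r => size r == k.+1) P -> good [:: e] P ->
  exists2 r, r \in P & K (\bigcup_(a <- r) a).
Proof.
elim: k e P => [|k IHk] e P sP Pk gP.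
  case: P sP Pk gP => // r P _ /andP[r1 Pk] gP; exists r; first exact: mem_head.
  case: r r1 gP => [|a []] // _ gP; rewrite big_seq1.
  apply: (good_face (P' := [:: [:: a]]) (u := a) gP _ _ (mem_head _ _)).
  - by apply/andP; split=> //; apply: sub_all Pk => r; rewrite -size_eq0 => /eqP->.
  - by rewrite sub1seq mem_head.
  - by apply/words_consP; exists a, set0; rewrite !inE setU0.
  exact: subsetUr.
have [v [Q [QP sQ gQ]]] := @merge_rows k (pattern_size c k) 1 [:: e] P isT sP Pk gP.
have [||_ /mapP[r rQ ->] Kr] := IHk (e :|: v) (map merge_top Q) _ _ gQ.
- by rewrite size_map sQ.
- apply/allP=> _ /mapP[r rQ ->]; rewrite /= size_drop.
  by have /eqP-> := allP Pk r (QP r rQ); rewrite subn2.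
exists r; first exact: QP.
have := allP Pk r (QP r rQ); case: r Kr {rQ} => [|a [|b r]] //= + _.
by rewrite /merge_top /= drop0 !big_cons setUA.
Qed.

End Patterns.

(** * Densities *)

(** [P] holds for a proportion at least [1 / a] of the elements of [T]. *)
Definition dense (T : finType) (a : nat) (P : pred T) : Prop := #|T| <= a * #|P|.

Lemma dense_sub (T : finType) a (P Q : pred T) :
  subpred P Q -> dense a P -> dense a Q.
Proof.
move=> sPQ; rewrite /dense => /leq_trans-> //; rewrite leq_mul2l subset_leq_card ?orbT //.
by apply/subsetP.
Qed.

Lemma dense_bij (T U : finType) a (P : pred T) (f : U -> T) :
  bijective f -> dense a P -> dense a [pred x | P (f x)].
Proof.
move=> bf; rewrite /dense (bij_eq_card bf) => /leq_trans-> //.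
rewrite leq_mul2l (_ : #|_| = #|P|) ?leqnn ?orbT //.
by rewrite -(on_card_preimset (onW_bij _ bf)) !cardsE cardE.
Qed.

Lemma card_pred_pair (X Z : finType) (P : X -> pred Z) :
  #|[pred u : X * Z | P u.1 u.2]| = \sum_x #|P x|.
Proof.
rewrite -sum1_card (eq_bigr (fun x => \sum_(z | P x z) 1)).
  by rewrite pair_big_dep.
by move=> x _; rewrite sum1_card.
Qed.

(** If [P] is dense, then so are sufficiently many of its fibres, hence [Q] is
dense as soon as it is dense over each [x] whose fibre in [P] is dense. *)
Lemma dense_fibre (X Z Z' : finType) (P : X -> pred Z) (Q : X -> pred Z') a c :
  0 < a -> dense a [pred u : X * Z | P u.1 u.2] ->
  (forall x, dense (2 * a) (P x) -> dense c (Q x)) ->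
  dense (2 * a * c) [pred u : X * Z' | Q u.1 u.2].
Proof.
move=> a0 dP PQ; pose pop x := #|Z| <= 2 * a * #|P x|.
have: #|X| <= 2 * a * #|pop| \/ #|Z| = 0.
  have [->|Z0] := posnP #|Z|; [by right | left].
  move: dP; rewrite /dense card_prod card_pred_pair.
  rewrite (bigID pop) /= mulnDr => dP.
  have b1 : a * \sum_(x | pop x) #|P x| <= a * #|pop| * #|Z|.
    rewrite -mulnA leq_mul2l -sum_nat_const leq_sum ?orbT // => x _.
    exact: max_card.
  have b2 : 2 * (a * \sum_(x | ~~ pop x) #|P x|) <= #|X| * #|Z|.
    rewrite mulnA big_distrr /= -sum_nat_const.
    apply: leq_trans (_ : \sum_(x | ~~ pop x) #|Z| <= _).
      by apply: leq_sum => x; rewrite -ltnNge => /ltnW.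
    by rewrite [X in _ <= X](bigID pop) /= leq_addl.
  rewrite -(leq_pmul2r Z0); move: dP b1 b2; set s1 := a * _; set s2 := a * _.
  rewrite -!mulnA; move: (a * (_ * _)) (#|X| * #|Z|) => u v; lia.
rewrite /dense card_prod card_pred_pair big_distrr /=.
case=> [dX|Z0].
  apply: leq_trans (_ : \sum_(x | pop x) 2 * a * #|Z'| <= _).
    rewrite sum_nat_const; apply: leq_trans (leq_mul dX (leqnn _)) _.
    by rewrite [_ * #|pop|]mulnC -mulnA.
  rewrite [X in _ <= X](bigID pop) /= (leq_trans _ (leq_addr _ _)) // leq_sum // => x px.
  by rewrite -(mulnA (2 * a)) leq_mul2l; apply/orP; right; apply: PQ.
rewrite -sum_nat_const leq_sum // => x _.
have /leq_trans-> // : #|Z'| <= c * #|Q x| by apply: PQ; rewrite /dense Z0.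
by rewrite -mulnA leq_pmull // muln_gt0.
Qed.

Lemma dense_power (I Z : finType) a (P : pred Z) : dense a P ->
  dense (a ^ #|I|) [pred g : {ffun I -> Z} | [forall i, P (g i)]].
Proof.
rewrite /dense => dP; rewrite card_ffun.
rewrite (_ : #|[pred g : {ffun I -> Z} | _]| = #|P| ^ #|I|).
  by rewrite -expnMn; case: #|I| => // k; rewrite leq_exp2r.
rewrite -card_ffun_on; apply: eq_card => g; rewrite !inE.
by apply/forallP/ffun_onP.
Qed.

Lemma card_bigcup_leq (I T : finType) (P : pred I) (A : I -> {set T}) :
  #|\bigcup_(i | P i) A i| <= \sum_(i | P i) #|A i|.
Proof.
elim/big_rec2: _ => [|i n B _ IH]; first by rewrite cards0.
by apply: leq_trans (leq_card_setU _ _) _; rewrite leq_add2l.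
Qed.

Lemma card_four_points (S V : finType) (P : pred (V * V * V * V)) (s1 s2 s3 s4 : S) :
  uniq [:: s1; s2; s3; s4] ->
  #|[set g : {ffun S -> V} | P (g s1, g s2, g s3, g s4)]| <= #|P| * #|V| ^ (#|S| - 4).
Proof.
move=> us; pose q := [:: s1; s2; s3; s4].
pose U := {s : S | s \notin q}.
have cU : #|{: U}| = #|S| - 4.
  rewrite card_sig -(cardC [pred s in q]) (card_uniqP us) addKn.
  by apply: eq_card.
pose h (g : {ffun S -> V}) := ((g s1, g s2, g s3, g s4), [ffun u : U => g (val u)]).
have hI : injective h.
  move=> g g' [e1 e2 e3 e4 /ffunP eU]; apply/ffunP=> s.
  have [|sq] := boolP (s \in q); first by rewrite !inE => /or4P[]/eqP->.
  by have := eU (exist _ s sq); rewrite !ffunE.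
rewrite -(card_imset _ hI) -cU -card_ffun -cardX.
apply: subset_leq_card; apply/subsetP=> _ /imsetP[g gP ->].
by move: gP; rewrite !inE /= andbT.
Qed.

(** * Faces of every size *)

(** A complete tripartite system of triples that are faces over [e] has a
quadruple of distinct positions that is a face over [e]. *)
Definition box_closed (V : finType) (K : pred {set V}) :=
  forall (e : {set V}) (g : box_position -> V),
    (forall i j p, K (e :|: [set g (inl (inl i)); g (inl (inr j)); g (inr p)])) ->
    exists s1 s2 s3 s4, uniq [:: s1; s2; s3; s4] /\
      K (e :|: [set g s1; g s2; g s3; g s4]).

Lemma card_box_position : #|box_position| = 35.
Proof. by rewrite !card_sum card_prod !card_ord. Qed.

(** The three factors come from blowing up the third, second and first vertex of
a triple to 25, 5 and 5 copies; the last one counts quadruples of positions. *)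
Definition box_const (a : nat) :=
  let a1 := 2 * a * (2 * a) ^ 25 in
  let a2 := 2 * a1 * (2 * a1) ^ 5 in
  let a3 := 2 * a2 * (2 * a2) ^ 5 in
  a3 * #|box_position| ^ 4.

Lemma box_const_gt0 a : 0 < a -> 0 < box_const a.
Proof. by move=> a0; rewrite /box_const !(muln_gt0, expn_gt0) a0 card_box_position. Qed.

(** A dense set of triples contains a positive proportion of the boxes of size
5, 5, 25; each of these yields a quadruple. *)
Lemma triples_to_quadruples (V : finType) (K : pred {set V}) (e : {set V}) a :
  box_closed K -> 0 < a ->
  dense a [pred u : V * V * V | K (e :|: [set u.1.1; u.1.2; u.2])] ->
  dense (box_const a)
    [pred u : V * V * V * V | K (e :|: [set u.1.1.1; u.1.1.2; u.1.2; u.2])].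
Proof.
move=> boxK a0 d0; rewrite /box_const; set a1 := 2 * a * _; set a2 := 2 * a1 * _.
set a3 := 2 * a2 * _; pose C := {ffun 'I_5 * 'I_5 -> V}; pose B := {ffun 'I_5 -> V}.
have a10 : 0 < a1 by rewrite /a1 !(muln_gt0, expn_gt0) a0.
have a20 : 0 < a2 by rewrite /a2 !(muln_gt0, expn_gt0) a0.
pose t x y z := K (e :|: [set x; y; z]).
have d1 : dense a1 [pred u : V * V * C | [forall p, t u.1.1 u.1.2 (u.2 p)]].
  apply: (@dense_fibre _ _ _ (fun (u : V * V) (z : V) => t u.1 u.2 z)
    (fun u (h : C) => [forall p, t u.1 u.2 (h p)]) a ((2 * a) ^ 25) a0 d0) => u du.
  have := dense_power ('I_5 * 'I_5)%type du.
  by rewrite card_prod !card_ord.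
have bij1 : bijective (fun u : V * C * V => (u.1.1, u.2, u.1.2) : V * V * C).
  by exists (fun u : V * V * C => (u.1.1, u.2, u.1.2)) => [[[]]|[[]]].
have d2 : dense a2 [pred u : V * C * B |
    [forall j, forall p, t u.1.1 (u.2 j) (u.1.2 p)]].
  apply: (@dense_fibre _ _ _ (fun (u : V * C) (z : V) => [forall p, t u.1 z (u.2 p)])
    (fun u (h : B) => [forall j, forall p, t u.1 (h j) (u.2 p)])
    a1 ((2 * a1) ^ 5) a10 (dense_bij bij1 d1)) => u du.
  by have := dense_power 'I_5 du; rewrite card_ord.
have bij2 : bijective (fun u : C * B * V => (u.2, u.1.1, u.1.2) : V * C * B).
  by exists (fun u : V * C * B => (u.1.2, u.2, u.1.1)) => [[[]]|[[]]].
have d3 : dense a3 [pred u : C * B * B |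
    [forall i, forall j, forall p, t (u.2 i) (u.1.2 j) (u.1.1 p)]].
  apply: (@dense_fibre _ _ _ (fun (u : C * B) (z : V) => [forall j, forall p, t z (u.2 j) (u.1 p)])
    (fun u (h : B) => [forall i, forall j, forall p, t (h i) (u.2 j) (u.1 p)])
    a2 ((2 * a2) ^ 5) a20 (dense_bij bij2 d2)) => u du.
  by have := dense_power 'I_5 du; rewrite card_ord.
set Q := [pred u : V * V * V * V | _].
pose h (u : C * B * B) : {ffun box_position -> V} := [ffun s => match s with
  | inl (inl i) => u.2 i | inl (inr j) => u.1.2 j | inr p => u.1.1 p end].
have hI : injective h.
  move=> [[c b] x] [[c' b'] x'] /ffunP E; congr (_, _, _); apply/ffunP => i.
  - by have := E (inr i); rewrite !ffunE.
  - by have := E (inl (inr i)); rewrite !ffunE.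
  by have := E (inl (inl i)); rewrite !ffunE.
pose W := (box_position * box_position * box_position * box_position)%type.
set k := #|box_position|.
have k4 : 4 <= k by rewrite /k card_box_position.
have cnt : #|V| ^ k <= a3 * (k ^ 4 * (#|Q| * #|V| ^ (k - 4))).
  have -> : #|V| ^ k = #|{: C * B * B}|.
    by rewrite !card_prod !card_ffun card_prod !card_ord -!expnD /k card_box_position.
  apply: leq_trans d3 _; rewrite leq_mul2l; apply/orP; right.
  rewrite -(card_imset _ hI).
  apply: leq_trans (_ : #|\bigcup_(q : W | uniq [:: q.1.1.1; q.1.1.2; q.1.2; q.2])
    [set g : {ffun box_position -> V} | Q (g q.1.1.1, g q.1.1.2, g q.1.2, g q.2)]| <= _).
    apply: subset_leq_card; apply/subsetP => _ /imsetP[u + ->].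
    rewrite inE => /forallP fu.
    have [i j p|s1 [s2 [s3 [s4 [us Ks]]]]] := @boxK e (h u).
      by rewrite !ffunE; have /forallP/(_ j)/forallP/(_ p) := fu i.
    by apply/bigcupP; exists (s1, s2, s3, s4); rewrite ?inE.
  apply: leq_trans (card_bigcup_leq _ _) _.
  apply: leq_trans (_ : \sum_(q : W) #|Q| * #|V| ^ (k - 4) <= _); last first.
    by rewrite sum_nat_const !card_prod -/k !expnS muln1 !mulnA.
  rewrite [X in X <= _]big_mkcond leq_sum // => q _; case: ifP => // uq.
  exact: card_four_points.
rewrite /dense !card_prod; have [->|V0] := posnP #|V|; first by rewrite muln0.
have Vk : 0 < #|V| ^ (k - 4) by rewrite expn_gt0 V0.
rewrite -(leq_pmul2r Vk) -!(mulnA a3) -(mulnA (k ^ 4)).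
apply: leq_trans cnt; rewrite -[in X in _ <= X](subnKC k4) expnD.
by rewrite !expnS muln1 !mulnA.
Qed.

(** Sequences of length [m], as iterated products so that the first entry can be
split off by computation. *)
Fixpoint power (T : finType) (m : nat) : finType :=
  if m is m'.+1 then (T * power T m')%type : finType else unit.

(** The set of entries of a sequence. *)
Fixpoint entries (V : finType) (m : nat) : power V m -> {set V} :=
  if m is m'.+1 then fun y => y.1 |: @entries V m' y.2 else fun=> set0.
Arguments entries V m : clear implicits.

(** The inverse density of faces among the sequences of length [m.+3]. *)
Fixpoint face_const (a m : nat) : nat :=
  if m is m'.+1 then
    2 * face_const a m' * box_const (2 * face_const a m') else a.

Lemma face_const_gt0 a m : 0 < a -> 0 < face_const a m.
Proof. by move=> a0; elim: m => // m IHm; rewrite muln_gt0 box_const_gt0 muln_gt0 IHm. Qed.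

(** The step from [m.+3] to [m.+4] applies [triples_to_quadruples] over the base
formed by the last [m] entries. *)
Lemma dense_faces (V : finType) (K : pred {set V}) a m :
  box_closed K -> 0 < a ->
  dense a [pred u : V * V * V | K [set u.1.1; u.1.2; u.2]] ->
  dense (face_const a m) [pred y : power V m.+3 | K (entries V m.+3 y)].
Proof.
move=> boxK a0 da; elim: m => [|m IHm] /=.
  have bij : bijective (fun y : power V 3 => (y.1, y.2.1, y.2.2.1) : V * V * V).
    by exists (fun u : V * V * V => (u.1.1, (u.1.2, (u.2, tt)))) => [[? [? [? []]]]|[[]]].
  apply: dense_sub (dense_bij bij da) => y /=.
  by rewrite setU0 setUA.
set c := face_const a m in IHm *.
have c0 : 0 < c by apply: face_const_gt0.
have bij1 : bijective (fun u : power V m * (V * V * V) =>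
    (u.2.1.1, (u.2.1.2, (u.2.2, u.1))) : power V m.+3).
  exists (fun y : power V m.+3 => (y.2.2.2, (y.1, y.2.1, y.2.2.1))).
    by move=> [y [[]]].
  by move=> [? [? [? ?]]].
have d1 := @dense_fibre _ _ _
  (fun (y : power V m) (u : V * V * V) => K (entries V m y :|: [set u.1.1; u.1.2; u.2]))
  (fun (y : power V m) (u : V * V * V * V) =>
     K (entries V m y :|: [set u.1.1.1; u.1.1.2; u.1.2; u.2]))
  c (box_const (2 * c)) c0 _ _.
have bij2 : bijective (fun y : power V m.+4 =>
    (y.2.2.2.2, (y.1, y.2.1, y.2.2.1, y.2.2.2.1)) : power V m * (V * V * V * V)).
  exists (fun u : power V m * (V * V * V * V) =>
    (u.2.1.1.1, (u.2.1.1.2, (u.2.1.2, (u.2.2, u.1)))) : power V m.+4).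
    by move=> [? [? [? [? ?]]]].
  by move=> [y [[[]]]].
apply: dense_sub (dense_bij bij2 (d1 _ _)) => [y|| y dy].
- by rewrite /= [X in K X -> _]setUC !setUA.
- apply: dense_sub (dense_bij bij1 IHm) => u.
  by rewrite /= [X in _ -> K X]setUC !setUA.
by apply: triples_to_quadruples => //; rewrite muln_gt0.
Qed.

(** * Large faces *)

(** Non-faces contain non-faces of at most [k] elements. *)
Definition helly_closed (k : nat) (V : finType) (K : pred {set V}) :=
  forall S : {set V}, ~~ K S ->
    exists T : {set V}, [/\ T \subset S, ~~ K T & #|T| <= k].

(** The row formed by the singletons of the entries of [t]. *)
Definition letters (V : finType) k (t : {ffun 'I_k -> V}) : seq {set V} :=
  [seq [set t c] | c <- enum 'I_k].

Lemma bigcup_letters (V : finType) k (t : {ffun 'I_k -> V}) :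
  \bigcup_(a <- letters t) a = [set t c | c in 'I_k].
Proof.
rewrite big_map big_enum /=; apply/setP => v.
apply/bigcupP/imsetP => [[c _ /set1P->]|[c _ ->]]; exists c => //.
exact: set11.
Qed.

Lemma words_choice (V : finType) (I : eqType) k (s : seq I)
    (f : I -> {ffun 'I_k.+1 -> V}) u :
  uniq s -> u \in words [seq letters (f i) | i <- s] ->
  exists w : I -> 'I_k.+1, u = \bigcup_(i <- s) [set f i (w i)].
Proof.
elim: s u => [|i s IHs] u /=.
  by rewrite inE => _ /eqP->; exists (fun=> ord0); rewrite big_nil.
case/andP=> nis us /words_consP[_ [v [/mapP[c _ ->] /(IHs _ us)[w ->] ->]]].
exists (fun j => if j == i then c else w j); rewrite big_cons eqxx; congr (_ :|: _).
rewrite !big_seq; apply: eq_bigr => j js.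
by case: eqP => // ji; rewrite -ji js in nis.
Qed.

Section LargeFace.
Variables (J V : finType) (K : pred {set V}).
Hypotheses (downK : down_closed K) (cubeK : cube_closed J K).
Hypotheses (hellyK : helly_closed 4 K) (K0 : K set0).
Implicit Types (S T W : {set V}).

(** Small non-faces are enumerated, with repetitions, by four entries. *)
Lemma nonface_four S : ~~ K S -> exists t : {ffun 'I_4 -> V},
  ~~ K [set t c | c in 'I_4] /\ forall c, t c \in S.
Proof.
case/hellyK=> T [sTS nT T4].
have [x xT] : exists x, x \in T.
  by apply/set0Pn; apply: contraNneq nT => ->.
pose t := [ffun c : 'I_4 => nth x (enum T) c].
have tT c : t c \in T.
  rewrite ffunE; have [cT|cT] := ltnP c (size (enum T)).
    by rewrite -mem_enum mem_nth.
  by rewrite nth_default.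
exists t; split=> [|c]; last exact: subsetP sTS _ (tT c).
apply: contraNN nT; apply: downK; apply/subsetP => y yT.
have yi : index y (enum T) < 4.
  by apply: leq_trans T4; rewrite cardE index_mem mem_enum.
by apply/imsetP; exists (Ordinal yi); rewrite // ffunE nth_index // mem_enum.
Qed.

(** Greedy choice: [q] is such that sets of at least [#|V| / q] elements are not
faces, so a non-face can be removed as long as that many elements remain. *)
Lemma disjoint_nonfaces q N W :
  (forall S, #|V| <= q * #|S| -> ~~ K S) ->
  (0 < N -> #|V| <= q * (#|W| - 4 * N.-1)) ->
  exists t : 'I_N -> {ffun 'I_4 -> V}, [/\ forall j, ~~ K [set t j c | c in 'I_4],
    forall j c, t j c \in W & forall j j' c c', t j c = t j' c' -> j = j'].
Proof.
move=> nbig; elim: N W => [|N IHN] W bigW.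
  have t : 'I_0 -> {ffun 'I_4 -> V} by case.
  by exists t; split=> [[]|[]|[]].
have [|t0 [nt0 t0W]] := @nonface_four W.
  apply: nbig; apply: leq_trans (bigW isT) _.
  by rewrite leq_mul2l leq_subr orbT.
pose T0 := [set t0 c | c in 'I_4].
have cT0 : #|T0| <= 4 by apply: leq_trans (leq_imset_card _ _) _; rewrite card_ord.
have [N0|t [nt tW td]] := IHN (W :\: T0).
  apply: leq_trans (bigW isT) _; rewrite leq_mul2l; apply/orP; right.
  by rewrite cardsD; have := subset_leq_card (subsetIr W T0); lia.
pose t' j := if unlift ord0 j is Some k then t k else t0; exists t'.
have tT0 k c c' : t k c = t0 c' -> False.
  move=> e; have := tW k c; rewrite e inE => /andP[/negP[]].
  by apply/imsetP; exists c'.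
split=> [j|j c|j j' c c'].
- by rewrite /t'; case: unliftP.
- by rewrite /t'; case: unliftP => // k _; have := tW k c; rewrite inE => /andP[].
rewrite /t'; case: (unliftP ord0 j) => [k ->|->]; case: (unliftP ord0 j') => [k' ->|->] //.
- by move/td->.
- by move/tT0.
by move/esym/tT0.
Qed.

(** The sequences of [M] elements of [W] that do not form a face. *)
Definition nonfaces_in M W : pred {ffun 'I_M -> V} :=
  [pred x : {ffun 'I_M -> V} | ~~ K [set x i | i in 'I_M] && [forall i, x i \in W]].

(** Supersaturation: if large sets are not faces, a large set [W] contains a
positive proportion of non-faces. Each sequence of [M] among the disjoint
four-element non-faces of [W] has, by [rainbow_pattern], a transversal that is
not a face, and the sequence can be recovered from it. *)
Lemma many_nonfaces g M W : pattern_size #|J| 3 <= M -> #|V| <= g * #|W| ->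
  (forall S, #|V| <= 2 * g * #|S| -> ~~ K S) ->
  dense ((8 * g) ^ M) (nonfaces_in (M := M) W).
Proof.
move=> pM gW nbig.
(* half of W is left before the last of the N quadruples is removed *)
pose N := (#|W| %/ 8).+1.
have [_|t [nt tW td]] := @disjoint_nonfaces (2 * g) N W nbig.
  apply: leq_trans gW _; rewrite (mulnC 2) -mulnA leq_mul2l; apply/orP; right.
  by rewrite /=; lia.
have pick (j : {ffun 'I_M -> 'I_N}) : exists x, nonfaces_in W x /\
    forall i, exists c, x i = t (j i) c.
  pose P := [seq letters (t (j i)) | i <- enum 'I_M].
  have [/hasP[u uP nu]|/hasPn allK] := boolP (has (fun u => ~~ K u) (words P)).
    have [w uE] := words_choice (f := fun i => t (j i)) (enum_uniq 'I_M) uP.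
    pose x := [ffun i => t (j i) (w i)]; exists x; split=> [|i]; last first.
      by exists (w i); rewrite ffunE.
    apply/andP; split; last by apply/forallP=> i; rewrite ffunE.
    apply: contraNN nu; apply: downK; rewrite uE big_enum /=.
    apply/bigcupsP=> i _; rewrite sub1set; apply/imsetP; exists i => //.
    by rewrite ffunE.
  have [||e u|r /mapP[i _ ->]] := @rainbow_pattern J V K downK cubeK 3 set0 P.
  - by rewrite size_map size_enum_ord.
  - by apply/allP=> _ /mapP[i _ ->]; rewrite size_map size_enum_ord.
  - by rewrite inE => /eqP-> /allK; rewrite negbK set0U.
  by rewrite bigcup_letters (negPf (nt _)).
have [U UP] := fin_all_exists pick.
have UI : injective U.
  move=> j j' eU; apply/ffunP=> i.
  have [c e] := (UP j).2 i; have [c' e'] := (UP j').2 i.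
  by apply: (td _ _ c c'); rewrite -e -e' eU.
rewrite /dense card_ffun card_ord.
apply: leq_trans (_ : (8 * g) ^ M * #|{ffun 'I_M -> 'I_N}| <= _).
  rewrite card_ffun !card_ord -expnMn.
  have : #|V| <= 8 * g * N.
    apply: leq_trans gW _; rewrite (mulnC 8) -mulnA leq_mul2l; apply/orP; right.
    by rewrite /N; lia.
  by case: (M) => // M' le; rewrite leq_exp2r.
rewrite leq_mul2l; apply/orP; right; rewrite -(card_imset _ UI).
by apply: subset_leq_card; apply/subsetP=> _ /imsetP[j _ ->]; have [] := UP j.
Qed.

End LargeFace.

(** The rows associated with a sequence of [i] non-faces. *)
Fixpoint letter_rows (V : finType) k i : power {ffun 'I_k -> V} i -> seq (seq {set V}) :=
  if i is i'.+1 then fun l => letters l.1 :: @letter_rows V k i' l.2 else fun=> [::].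
Arguments letter_rows V k i : clear implicits.

Lemma letter_rows_shape (V : finType) k i (l : power {ffun 'I_k -> V} i) :
  size (letter_rows V k i l) = i /\
  all (fun r => size r == k) (letter_rows V k i l).
Proof.
elim: i l => [|i IHi] //= [t l]; have [-> ->] := IHi l.
by rewrite /= size_map size_enum_ord eqxx.
Qed.

Lemma card_power (T : finType) i : #|power T i| = #|T| ^ i.
Proof.
elim: i => [|i IHi] /=; first by rewrite card_unit.
by rewrite card_prod IHi expnS.
Qed.

(** The inverse density of [rainbow_faces], when [D] is that of faces. *)
Fixpoint stage_const (D M i : nat) : nat :=
  if i is i'.+1 then
    2 * stage_const D M i' * (8 * (2 * stage_const D M i')) ^ M
  else D.

Lemma stage_const_gt0 D M i : 0 < D -> 0 < stage_const D M i.
Proof.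
by move=> D0; elim: i => // i IHi; rewrite muln_gt0 expn_gt0 !muln_gt0 IHi.
Qed.

Section Stages.
Variables (J V : finType) (K : pred {set V}) (M : nat).
Hypotheses (downK : down_closed K) (cubeK : cube_closed J K).
Hypotheses (hellyK : helly_closed 4 K) (K0 : K set0).
Hypotheses (M0 : 0 < M) (bigM : pattern_size #|J| 3 <= M).

(** Sequences of non-faces such that all the transversals are faces over [e]. *)
Definition rainbow_faces (e : {set V}) i (l : power {ffun 'I_M -> V} i) : bool :=
  all (fun r => ~~ K (\bigcup_(a <- r) a)) (letter_rows V M i l) &&
  all (fun u => K (e :|: u)) (words (letter_rows V M i l)).

(** One entry of a face after the other is replaced by a non-face whose elements
could all be used instead of that entry; [many_nonfaces] provides enough of
them inside the set [W] of the elements that could be used. *)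
Lemma dense_rainbow D i m : 0 < D -> i <= m ->
  (forall i', i' < i -> forall S : {set V},
     #|V| <= 4 * stage_const D M i' * #|S| -> ~~ K S) ->
  dense D [pred y : power V m | K (entries V m y)] ->
  dense (stage_const D M i) [pred u : power V (m - i) * power {ffun 'I_M -> V} i |
    rainbow_faces (entries V (m - i) u.1) u.2].
Proof.
move=> D0; elim: i => [|i IHi] im nbig dD.
  rewrite subn0.
  have bij : bijective (fun u : power V m * power {ffun 'I_M -> V} 0 => u.1).
    by exists (fun y : power V m => (y, tt) : power V m * power {ffun 'I_M -> V} 0) => [[? []]|].
  by apply: dense_sub (dense_bij bij dD) => u; rewrite /rainbow_faces /= setU0 andbT.
have {IHi} := IHi (ltnW im) (fun i' lt => nbig i' (ltnW lt)) dD.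
have -> : m - i = (m - i.+1).+1 by lia.
set j := m - i.+1; set c := stage_const D M i => dc.
have c0 : 0 < c by apply: stage_const_gt0.
have bij1 : bijective (fun u : power V j * power {ffun 'I_M -> V} i * V =>
    ((u.2, u.1.1), u.1.2) : power V j.+1 * power {ffun 'I_M -> V} i).
  exists (fun u : power V j.+1 * power {ffun 'I_M -> V} i => ((u.1.2, u.2), u.1.1)).
    by move=> [[? ?] ?].
  by move=> [[? ?] ?].
have bij2 : bijective (fun u : power V j * power {ffun 'I_M -> V} i.+1 =>
    ((u.1, u.2.2), u.2.1) : power V j * power {ffun 'I_M -> V} i * {ffun 'I_M -> V}).
  exists (fun u : power V j * power {ffun 'I_M -> V} i * {ffun 'I_M -> V} =>
    (u.1.1, (u.2, u.1.2)) : power V j * power {ffun 'I_M -> V} i.+1).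
    by move=> [? [? ?]].
  by move=> [[? ?] ?].
pose W (u : power V j * power {ffun 'I_M -> V} i) :=
  [set v | rainbow_faces (v |: entries V j u.1) u.2].
have dQ := @dense_fibre _ _ _
  (fun (u : power V j * power {ffun 'I_M -> V} i) (v : V) =>
     rainbow_faces (v |: entries V j u.1) u.2)
  (fun u => nonfaces_in K (M := M) (W u)) c ((8 * (2 * c)) ^ M) c0 (dense_bij bij1 dc) _.
apply: dense_sub (dense_bij bij2 (dQ _)) => [[y [t l]]|u du].
  move=> /andP[/= nt /forallP tW].
  have tl k : rainbow_faces (t k |: entries V j y) l by have := tW k; rewrite inE.
  rewrite /rainbow_faces /= bigcup_letters nt /=.
  have /andP[-> _] := tl (Ordinal M0); apply/allP=> v.
  case/words_consP=> _ [w [/mapP[k _ ->] wP ->]].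
  have /andP[_ /allP/(_ w wP)] := tl k.
  by rewrite setUA (setUC (entries V j y)).
apply: (many_nonfaces downK cubeK hellyK K0 bigM).
  by rewrite cardsE.
by move=> S; rewrite mulnA => /(nbig i (ltnSn i)).
Qed.

End Stages.

(** The constant must be larger than the one required at each stage of
[dense_rainbow], whence the sum. *)
Definition complex_const (c a : nat) : nat :=
  let M := (pattern_size c 3).+1 in
  let m := pattern_size c (pattern_size c 3) in
  (\sum_(i < m) 4 * stage_const (face_const a m) M i).+1.

(** If there were no large face, [dense_rainbow] would produce enough non-faces
with all transversals faces to contradict [rainbow_pattern]. *)
Lemma large_face (J V : finType) (K : pred {set V}) a :
  down_closed K -> cube_closed J K -> box_closed K -> helly_closed 4 K -> K set0 ->
  0 < a -> 0 < #|V| ->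
  dense a [pred u : V * V * V | K [set u.1.1; u.1.2; u.2]] ->
  exists2 S, K S & #|V| <= complex_const #|J| a * #|S|.
Proof.
move=> downK cubeK boxK hellyK K0 a0 V0 da.
set q := complex_const _ _.
have [/existsP[S /andP[]]|/existsPn small] :=
  boolP [exists S : {set V}, K S && (#|V| <= q * #|S|)]; first by exists S.
set M0 := pattern_size #|J| 3; set m := pattern_size #|J| M0.
set D := face_const a m.
have D0 : 0 < D by apply: face_const_gt0.
have nbig (S : {set V}) : #|V| <= q * #|S| -> ~~ K S.
  by move=> big; have := small S; rewrite big andbT.
have lem : m <= m.+3 by lia.
have big_stage i (im : i < m) (S : {set V}) :
    #|V| <= 4 * stage_const D M0.+1 i * #|S| -> ~~ K S.
  move=> VS; apply: nbig; apply: leq_trans VS _; rewrite leq_mul2r; apply/orP; right.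
  rewrite /q /complex_const -/M0 -/m -/D.
  by rewrite (bigD1 (Ordinal im)) //= -addSn leqW // leq_addr.
have := @dense_rainbow J V K M0.+1 downK cubeK hellyK K0 isT (leqnSn _) D m m.+3 D0
  lem big_stage (@dense_faces V K a m boxK a0 da).
rewrite /dense !card_prod !card_power card_ffun card_ord => d.
have /card_gt0P[[y l] /andP[/allP nf /allP ff]] : 0 < #|[pred u | rainbow_faces K
    (entries V (m.+3 - m) u.1) (u : power V (m.+3 - m) * power {ffun 'I_M0.+1 -> V} m).2]|.
  rewrite lt0n; apply: contraTneq d => ->.
  by rewrite muln0 -ltnNge !(muln_gt0, expn_gt0) V0.
have [sl al] := letter_rows_shape l.
have [|e u|r rl] := @rainbow_pattern J V K downK cubeK M0 (entries V _ y) _ _ al.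
- by rewrite sl.
- by rewrite inE => /eqP->; apply: ff.
by move/negP: (nf r rl).
Qed.

(** * Fractional Helly *)

(** The statement in terms of natural numbers; the constant is increased by two
so that a single member suffices when there are at most two. *)
Lemma large_nerve_face (G : sgraph) (n : nat) (F : 'I_n -> {set G}) a :
  ~ minor (complete 5) G -> connected_cover F -> 0 < a -> 0 < n ->
  'C(n, 3) <= a * #|intersecting_triples F| ->
  exists2 s, s \in nerve F &
    n <= (complex_const #|{: network_node * network_node}| (27 * a)).+2 * #|s|.
Proof.
move=> noK5 coverF a0 n0 tri.
have [n3|n3] := ltnP n 3.
  exists [set Ordinal n0]; first exact: face1.
  by rewrite cards1 muln1; lia.
have [||||||||s sF ns] := @large_face (network_node * network_node)%type 'I_n
  (fun s => s \in nerve F) (27 * a).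
- by move=> S T; apply: face_down.
- by move=> b x y; apply: nerve_cube.
- by move=> e g; apply: nerve_box.
- by move=> S; apply: nerve_helly4.
- by rewrite inE eqxx.
- by rewrite muln_gt0.
- by rewrite card_ord.
(* 'C(n, 3) is at least n ^ 3 / 27, and each three-element face can be ordered *)
- set P := [pred u | _].
  have tP : #|intersecting_triples F| <= #|P|.
    apply: leq_trans (leq_imset_card (fun u => [set u.1.1; u.1.2; u.2]) P).
    apply: subset_leq_card; apply/subsetP => s; rewrite inE => /andP[sF /eqP s3].
    have [x [y [z sE]]] : exists x y z, s = [set x; y; z].
      move: s3; rewrite cardE; have := @mem_enum _ (mem s).
      case: (enum s) => [|x [|y [|z []]]] // sE _; exists x, y, z.
      by apply/setP => v; rewrite -[v \in s]sE !inE orbA.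
    by apply/imsetP; exists (x, y, z); first rewrite /P inE /= -sE.
  rewrite /dense !card_prod !card_ord -(mulnA 27).
  apply: leq_trans (leq_mul (leqnn 27) (leq_trans tri (leq_mul (leqnn a) tP))).
  have binE : 'C(n, 3) * 6 = n * (n.-1 * n.-2).
    by have := bin_ffact n 3; rewrite !ffactnS ffactn0 muln1.
  rewrite -(leq_pmul2r (isT : 0 < 6)) -(mulnA 27) binE.
  by move: n3; clear; case: n => [|[|[|k]]] //= _; nia.
exists s => //; rewrite card_ord in ns; apply: leq_trans ns _.
by rewrite leq_mul2r (leqW (leqnSn _)) orbT.
Qed.

Import Order.TTheory GRing.Theory Num.Theory.
Local Open Scope ring_scope.

Theorem theorem4p3 (R : realType) (alpha : R) (halpha : 0 < alpha <= 1) :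
  exists2 beta : R, 0 < beta &
    forall (G : sgraph) (n : nat) (F : 'I_n -> {set G}),
      ~ minor (complete 5) G ->
      connected_cover F ->
      alpha * 'C(n, 3)%:R <= #|intersecting_triples F|%:R ->
      exists2 s : {set 'I_n}, s \in nerve F & beta * n%:R <= #|s|%:R.
Proof.
have /andP[alpha0 _] := halpha.
pose a := (Num.bound alpha^-1).+1.
have a_ge : alpha^-1 <= a%:R.
  apply/ltW; apply: lt_le_trans (archi_boundP _) _; first by rewrite invr_ge0 ltW.
  by rewrite ler_nat.
pose q := (complex_const #|{: network_node * network_node}| (27 * a)).+2.
have q0 : 0 < q%:R :> R by rewrite ltr0n.
exists q%:R^-1; first by rewrite invr_gt0.
move=> G [|n] F noK5 coverF tri.
  by exists set0; rewrite ?mulr0 // inE eqxx.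
have [|s sF ns] := large_nerve_face (a := a) noK5 coverF isT isT.
  rewrite -(ler_nat R) natrM; apply: le_trans (_ : alpha^-1 * #|intersecting_triples F|%:R <= _).
    by rewrite ler_pdivlMl.
  by rewrite ler_wpM2r.
by exists s => //; rewrite ler_pdivrMl // -natrM ler_nat.
Qed.
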